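(* For all integers $n\ge0$ and $k\ge j\ge0$, \begin{align*} \bar{a}_{3(k-j)+3,\, 3k+6}(3n+1)&\equiv 0 \pmod 3,\\ \bar{a}_{3(k-j)+3,\, 3k+6}(3n+2)&\equiv 0 \pmod 3,\\ \bar{a}_{3(k-j)+5,\, 3k+1}(3n+2)&\equiv 0 \pmod 3. \end{align*}
   Context: For $m\ge1$ let $f_m:=\prod_{k=1}^{\infty}(1-q^{mk})$. For integers $r,s\ge1$, $\bar{a}_{r,s}(n)$ denotes the number of overpartitions of $n$ (partitions in which the first occurrence of each part size may be overlined) wherein each even part may appear in one of $r$ colors and each odd part in one of $s$ colors; its generating function is \[ \sum_{n=0}^{\infty}\bar{a}_{r,s}(n)q^n=\frac{f_2^{3s-2r}}{f_1^{2s}f_4^{s-r}}. \] *)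

(* Defs.v *)
From mathcomp Require Import all_boot.

Set Implicit Arguments.
Unset Strict Implicit.
Unset Printing Implicit Defensive.

Definition ncolors (r s m : nat) : nat := if odd m then s else r.

(* The coloured part sizes available in a partition of n: the pair (i, c)
   stands for a part of size i.+1 in colour c. Sizes above n cannot occur. *)
Definition cpart (r s n : nat) : finType := {i : 'I_n & 'I_(ncolors r s i.+1)}.

Definition part_size (r s n : nat) (p : cpart r s n) : nat := (tag p).+1.

(* An overpartition is a pair (mu, O): mu gives the multiplicity of each
   coloured part (at most n, since part sizes are positive), and O is the set
   of coloured parts whose first occurrence is overlined. The same size in two
   colours counts as two different parts, each with its own first occurrence;
   this is what the product of ((1 + q^m) / (1 - q^m)) ^ (ncolors r s m) over
   m >= 1, the generating function of these objects, expresses. *)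
Definition overpartitions (r s n : nat) :
    {set {ffun cpart r s n -> 'I_n.+1} * {set cpart r s n}} :=
  [set w : {ffun cpart r s n -> 'I_n.+1} * {set cpart r s n} |
     (\sum_(p : cpart r s n) w.1 p * part_size p == n)
     && [forall p in w.2, 0 < w.1 p]].

Definition abar (r s n : nat) : nat := #|overpartitions r s n|.

(* Main.v *)
(* Modulo 3 a cube is a series in q^3. In the first two congruences both numbers
   of colours are multiples of 3, so the generating function is a cube. In the
   third one it is a cube times f_4 / (f_2 f_1^2), and multiplying by f_1^3 gives
   f_1 f_4 / f_2, which by Gauss is the sum of (-q)^T over the triangular numbers
   T; none of these is 2 modulo 3. Series are replaced by polynomials over F_3
   modulo X^(M+1) when the number of overpartitions of M is wanted. *)
Require Import Defs.
From mathcomp Require Import all_boot.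
From mathcomp Require Import all_algebra ring zify.

Set Implicit Arguments.
Unset Strict Implicit.
Unset Printing Implicit Defensive.

Import GRing.Theory.

(** * The generating function, and a finite form of Gauss' identity *)

Lemma card_subsets_pred (T : finType) (P : pred T) :
  #|[set O : {set T} | [forall p in O, P p]]| = \prod_(p : T) (if P p then 2 else 1).
Proof.
have -> : [set O : {set T} | [forall p in O, P p]] = powerset [set p | P p].
  apply/setP=> O; rewrite !inE; apply/forall_inP/subsetP => h p /h;
    by rewrite inE.
rewrite card_powerset -big_mkcond /= prod_nat_const cardsE //.
Qed.

Local Open Scope ring_scope.

Section OverpartitionSeries.
Variable R : comNzRingType.

(** Truncation of (1 + q^m) / (1 - q^m): a part that occurs is overlined or not, whence the weight 2
    for e > 0. *)
Definition part_series (M m : nat) : {poly R} :=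
  \sum_(e < M.+1) 'X^(e * m) *+ (if (0 < e)%N then 2 else 1).

Lemma part_seriesE (M m : nat) :
  (1 - 'X^m) * part_series M m = 1 + 'X^m - 'X^(M.+1 * m) *+ 2.
Proof.
rewrite /part_series; elim: M => [|M IH].
  by rewrite big_ord1 /= mul0n mul1n expr0; ring.
rewrite big_ord_recr /= mulrDr IH [(M.+2 * m)%N]mulSn exprD; ring.
Qed.

(** Expanding the product over coloured parts gives one term for each multiplicity function mu; its
    weight, a power of 2, counts the sets O of overlined parts compatible with mu. *)
Lemma abar_coef (r s M : nat) :
  (abar r s M)%:R = (\prod_(i < M) part_series M i.+1 ^+ ncolors r s i.+1)`_M.
Proof.
have -> : \prod_(i < M) part_series M i.+1 ^+ ncolors r s i.+1 =
  \prod_(p : cpart r s M) part_series M (part_size p).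
  rewrite -(sig_big_dep xpredT (fun _ => xpredT)
              (fun (i : 'I_M) (_ : 'I_(ncolors r s i.+1)) => part_series M i.+1)) /=.
  by apply: eq_bigr => i _; rewrite prodr_const card_ord.
rewrite bigA_distr_bigA /= coef_sum /abar /overpartitions.
rewrite -sum1_card.
rewrite (eq_bigl (fun w : {ffun cpart r s M -> 'I_M.+1} * {set cpart r s M} =>
  (\sum_p w.1 p * part_size p == M)%N && [forall p in w.2, (0 < w.1 p)%N])); last first.
  by move=> w; rewrite inE.
rewrite -(pair_big_dep (fun mu : {ffun cpart r s M -> 'I_M.+1} =>
    (\sum_p mu p * part_size p)%N == M)
  (fun (mu : {ffun cpart r s M -> 'I_M.+1}) (O : {set cpart r s M}) =>
    [forall p in O, (0 < mu p)%N]) (fun _ _ => 1%N)) /=.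
rewrite natr_sum big_mkcond /=; apply: eq_bigr => mu _.
rewrite sum1dep_card card_subsets_pred.
rewrite [in RHS](eq_bigr _ (fun p _ => esym (mulr_natr _ _))).
rewrite big_split /= -expr_sum -natr_prod mulr_natr coefMn coefXn eq_sym.
by case: eqP => _; rewrite ?mul0rn.
Qed.

(* The bracket is what separates the two sides of Shanks' identity when n
   becomes n + 1; the sum telescopes. *)
Lemma shanks_partial (x : R) (n k : nat) : (k <= n)%N ->
  \sum_(s < k.+1) (\prod_(i < s) (1 - x ^+ (2 * i).+1)) *
     (\prod_(s <= i < n) (1 - x ^+ (2 * i.+1))) * x ^+ (s * (2 * n).+1) *
     (x ^+ (2 * s) - x ^+ (2 * n + 2 + 2 * s) - 1 + x ^+ (2 * n).+1)
  = x ^+ (k.+1 * (2 * n).+1) * (\prod_(i < k.+1) (1 - x ^+ (2 * i).+1)) *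
     (\prod_(k <= i < n) (1 - x ^+ (2 * i.+1))).
Proof.
elim: k => [|k IH] kn.
  by rewrite !big_ord1 big_ord0 /= !muln0 !mul0n !mul1n addn0 !expr0 !exprS
             !exprD; ring.
rewrite big_ord_recr /= IH ?(ltnW kn) // [in LHS](big_ltn kn).
rewrite [in RHS]big_ord_recr /=.
set D := \prod_(i < k.+1) _; set E := \prod_(k.+1 <= i < n) _.
have -> : x ^+ (2 * n + 2 + 2 * k.+1) = x ^+ (2 * n).+1 * x * x ^+ (2 * k.+1).
  by rewrite -exprSr -exprD; congr (x ^+ _); lia.
rewrite [(k.+2 * (2 * n).+1)%N]mulSnr exprD [x ^+ (2 * k.+1).+1]exprS; ring.
Qed.

(* A finite form, due to Shanks, of Gauss' identity for the triangular numbers: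
   the terms with s > 0 on the left are divisible by x ^ (2 n + 1). *)
Lemma shanks (x : R) (n : nat) :
  \sum_(s < n) (\prod_(i < s) (1 - x ^+ (2 * i).+1)) *
     (\prod_(s <= i < n) (1 - x ^+ (2 * i.+1))) * x ^+ (s * (2 * n).+1)
  = (\prod_(i < n) (1 - x ^+ (2 * i).+1)) * \sum_(t < 2 * n) x ^+ 'C(t.+1, 2).
Proof.
elim: n => [|n IH]; first by rewrite !big_ord0 mulr0.
set D := \prod_(i < n) (1 - x ^+ (2 * i).+1) in IH.
(* The induction hypothesis with one term more on each side: t = 2n matches s = n, since 'C(2n+1, 2)
   = n (2n+1). *)
have B : D * \sum_(t < (2 * n).+1) x ^+ 'C(t.+1, 2) =
  \sum_(s < n.+1) (\prod_(i < s) (1 - x ^+ (2 * i).+1)) *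
     (\prod_(s <= i < n) (1 - x ^+ (2 * i.+1))) * x ^+ (s * (2 * n).+1).
  rewrite !big_ord_recr /= mulrDr -IH big_geq // mulr1; congr (_ + _ * x ^+ _).
  by rewrite bin2 -[(2 * n).+1.-1]/(2 * n)%N mulnCA mul2n doubleK mulnC.
have -> : (2 * n.+1 = (2 * n).+2)%N by lia.
rewrite [\sum_(t < (2 * n).+2) _]big_ord_recr [\prod_(i < n.+1) _]big_ord_recr /= -/D.
set T := \sum_(t < (2 * n).+1) _.
rewrite [RHS](_ : _ = (1 - x ^+ (2 * n).+1) * (D * T)
   + D * (1 - x ^+ (2 * n).+1) * x ^+ 'C((2 * n).+2, 2)); last by ring.
rewrite B.
have -> : 'C((2 * n).+2, 2) = (n.+1 * (2 * n).+1)%N.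
  by rewrite bin2 succnK (_ : (2 * n).+2 = n.+1.*2) -?doubleMl ?doubleK //; lia.
(* At k = n the partial sum rewrites the last term, that of t = 2n+1, as a sum over s; the two sides
   then agree term by term. *)
have := shanks_partial x (leqnn n).
rewrite [\prod_(n <= i < n) _]big_geq // mulr1 [in RHS]big_ord_recr /= -/D.
rewrite [X in _ = X -> _]mulrC => <-.
rewrite big_distrr -big_split /=; apply: eq_bigr => s _.
rewrite big_nat_recr /=; last by rewrite -ltnS.
have -> : (s * (2 * n).+3 = s * (2 * n).+1 + 2 * s)%N by lia.
have -> : (2 * n + 2 + 2 * s = (2 * n).+2 + 2 * s)%N by lia.
have -> : (2 * n.+1 = (2 * n).+2)%N by lia.
rewrite exprD [x ^+ ((2 * n).+2 + _)]exprD; ring.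
Qed.

End OverpartitionSeries.

(** * Coefficients of p-th powers in characteristic p *)

Section FrobeniusCoefficients.
Variables (R : comNzRingType) (p : nat).
Hypothesis pcharRp : p \in [pchar R].

(** Frobenius is additive, so u ^+ p is a combination of the monomials X^(p k). *)
Lemma coef_exp_pchar (u : {poly R}) (i : nat) : ~~ (p %| i)%N -> (u ^+ p)`_i = 0.
Proof.
move=> pNi; have pP : p \in [pchar {poly R}].
  exact: (rmorph_pchar (@polyC R)).
rewrite -[u]coefK poly_def -(pFrobenius_autE pP) raddf_sum coef_sum big1 // => k _.
rewrite /= pFrobenius_autE exprZn -exprM coefZ coefXn.
by case: eqP pNi => [->|_]; rewrite ?mulr0 // dvdn_mull.
Qed.

Lemma coef_mul_exp_pchar (u q : {poly R}) (N c : nat) :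
  (forall i, (i < N)%N -> i = c %[mod p] -> q`_i = 0) ->
  forall i, (i < N)%N -> i = c %[mod p] -> (u ^+ p * q)`_i = 0.
Proof.
move=> q0 i iN ic; rewrite coefM big1 // => -[l /= li] _.
have [pl|/coef_exp_pchar->] := boolP (p %| l)%N; last by rewrite mul0r.
rewrite q0 ?mulr0 //; first exact: leq_ltn_trans (leq_subr _ _) iN.
by rewrite -ic -{2}(subnK (li : l <= i)%N) -modnDmr (eqP pl) addn0.
Qed.

(** Strong induction on i: the nonconstant terms of u ^+ p meet coefficients of q at smaller indices
    of the same residue class, which are 0, and the constant term is 1. *)
Lemma coef_cancel_exp_pchar (u q : {poly R}) (N c : nat) : u`_0 = 1 ->
  (forall i, (i < N)%N -> i = c %[mod p] -> (u ^+ p * q)`_i = 0) ->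
  forall i, (i < N)%N -> i = c %[mod p] -> q`_i = 0.
Proof.
move=> u0 uq0; elim/ltn_ind => i IH iN ic.
have := uq0 i iN ic; rewrite coefM big_ord_recl /= subn0.
rewrite -horner_coef0 horner_exp horner_coef0 u0 expr1n mul1r big1 ?addr0 // => -[l /= li] _.
rewrite /bump /= add1n.
have [pl|/coef_exp_pchar->] := boolP (p %| l.+1)%N; last by rewrite mul0r.
rewrite IH ?mulr0 //; first lia.
  exact: leq_ltn_trans (leq_subr _ _) iN.
by rewrite -ic -{2}(subnK (li : l.+1 <= i)%N) -modnDmr (eqP pl) addn0.
Qed.

End FrobeniusCoefficients.

(** * Congruences modulo X^N, and Gauss' identity for the residual factor *)

Section Truncation.
Variable F : fieldType.
Implicit Types p q : {poly F}.

Definition eqX (N : nat) p q := 'X^N %| p - q.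

Lemma eqXX N p : eqX N p p.
Proof. by rewrite /eqX subrr dvdp0. Qed.

Lemma eqX_sym N p q : eqX N p q = eqX N q p.
Proof. by rewrite /eqX -dvdpNr opprB. Qed.

Lemma eqX_trans N q p r : eqX N p q -> eqX N q r -> eqX N p r.
Proof. by move=> pq qr; rewrite /eqX -(subrKA q) dvdp_add. Qed.

Lemma eqXM N p p' q q' : eqX N p p' -> eqX N q q' -> eqX N (p * q) (p' * q').
Proof.
move=> pp qq; rewrite /eqX (_ : _ - _ = (p - p') * q + p' * (q - q')); last by ring.
by apply: dvdp_add; [apply: dvdp_mulr | apply: dvdp_mull].
Qed.

Lemma eqX_prod N (I : finType) (P : pred I) (f g : I -> {poly F}) :
  (forall i, P i -> eqX N (f i) (g i)) -> eqX N (\prod_(i | P i) f i) (\prod_(i | P i) g i).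
Proof. by move=> fg; elim/big_ind2: _ => *; rewrite ?eqXX ?eqXM ?fg. Qed.

Lemma eqX_exp N p q k : eqX N p q -> eqX N (p ^+ k) (q ^+ k).
Proof. by move=> pq; elim: k => [|k IH]; rewrite ?eqXX // !exprS eqXM. Qed.

Lemma eqX_coef N p q i : eqX N p q -> (i < N)%N -> p`_i = q`_i.
Proof.
by move=> /dvdpP[w pq] iN; apply/eqP; rewrite -subr_eq0 -coefB pq coefMXn iN.
Qed.

(** A polynomial with nonzero constant term is coprime to X^N. *)
Lemma eqX_cancel N p q r : p.[0] != 0 -> eqX N (p * q) (p * r) -> eqX N q r.
Proof.
move=> p0; rewrite /eqX -mulrBr Gauss_dvdpr // coprimep_expl //.
by rewrite coprimep_sym coprimepX.
Qed.

Lemma part_series_eqX M m : (0 < m)%N ->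
  eqX M.+1 ((1 - 'X^m) * part_series F M m) (1 + 'X^m).
Proof.
move=> m0; rewrite part_seriesE /eqX addrAC subrr add0r dvdpNr -mulr_natr.
by rewrite dvdp_mulr // dvdp_exp2l // leq_pmulr.
Qed.

(** The factors with m > M are 1 modulo X^N. Since m = i + 1, [b = false] selects the odd m. *)
Lemma prod_odd_even N M (f : nat -> {poly F}) (b : bool) : (N <= M.+1)%N ->
  (forall m, (M < m)%N -> eqX N (f m) 1) ->
  eqX N (\prod_(i < M) f (2 * i + b).+1) (\prod_(i < M | odd i == b) f i.+1).
Proof.
move=> NM f1.
have -> : \prod_(i < M) f (2 * i + b).+1 = \prod_(i < M + M | odd i == b) f i.+1.
  rewrite addnn -mul2n; elim: M {NM f1} => [|M IH]; first by rewrite !big_ord0.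
  have -> : (2 * M.+1 = (2 * M).+2)%N by lia.
  rewrite big_ord_recr IH /= [RHS]big_mkcond /= 2!big_ord_recr /= -big_mkcond.
  by rewrite mul2n odd_double /=; case: b {IH}; rewrite /= ?addn1 ?addn0 ?mulr1.
rewrite big_split_ord -[X in eqX _ _ X]mulr1; apply: eqXM; first exact: eqXX.
apply: (@eqX_trans _ (\prod_(i < M | odd (M + i) == b) 1)); last by rewrite big1 ?eqXX.
by apply: eqX_prod => i _; apply: f1; rewrite /= ltnS leq_addr.
Qed.

Lemma overpartition21_eqX M (u := \prod_(i < M) (1 - 'X^(i.+1) : {poly F})) : (0 < M)%N ->
  eqX M.+1 (u ^+ 3 * \prod_(i < M) part_series F M i.+1 ^+ ncolors 2 1 i.+1)
    (\sum_(t < 2 * M) (- 'X) ^+ 'C(t.+1, 2)).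
Proof.
move=> M0.
(* Shanks' identity is used at x = -X, where D is the product of 1 + X^m over odd m, and E that of 1
   - X^m over even m. *)
pose D := \prod_(i < M) (1 - (- 'X : {poly F}) ^+ (2 * i).+1).
pose E := \prod_(i < M) (1 - (- 'X : {poly F}) ^+ (2 * i.+1)).
have signX i : (- 'X : {poly F}) ^+ i = (-1) ^+ odd i * 'X^i.
  by rewrite signr_odd -exprNn.
have X1 c m : (M < m)%N -> eqX M.+1 (1 + c * 'X^m) 1.
  by move=> Mm; rewrite /eqX addrAC subrr add0r dvdp_mull // dvdp_exp2l.
have DE : eqX M.+1 D (\prod_(i < M | odd i == false) (1 + 'X^(i.+1))).
  have := @prod_odd_even M.+1 M (fun m => 1 + 1 * 'X^m) false (leqnn _) (X1 1).
  congr eqX; apply: eq_bigr => i _; last by rewrite mul1r.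
  rewrite signX addn0 /= mul2n odd_double; ring.
have EE : eqX M.+1 E (\prod_(i < M | odd i == true) (1 - 'X^(i.+1))).
  have := @prod_odd_even M.+1 M (fun m => 1 + -1 * 'X^m) true (leqnn _) (X1 (-1)).
  congr eqX; apply: eq_bigr => i _; last by rewrite mulN1r.
  rewrite signX addn1 (_ : (2 * i.+1 = (2 * i).+2)%N) ?mul2n /= ?odd_double; last lia.
  by rewrite mulN1r mul1r.
have EP : E = u * \prod_(i < M) (1 + 'X^(i.+1)).
  rewrite -big_split; apply: eq_bigr => i _ /=.
  by rewrite signX mul2n odd_double -muln2 exprM; ring.
have D0 : D.[0] != 0.
  rewrite horner_prod; apply/prodf_neq0 => i _.
  by rewrite !hornerE oppr0 expr0n subr0 oner_neq0.
apply: (eqX_cancel D0); rewrite -shanks -/D; apply: (@eqX_trans _ E).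
  have uG : eqX M.+1 (u ^+ 3 * \prod_(i < M) part_series F M i.+1 ^+ ncolors 2 1 i.+1)
     (\prod_(i < M) ((1 - 'X^(i.+1)) ^+ (3 - ncolors 2 1 i.+1) *
         (1 + 'X^(i.+1)) ^+ ncolors 2 1 i.+1)).
    rewrite /u -prodrXl -big_split; apply: eqX_prod => i _ /=.
    have c3 : (ncolors 2 1 i.+1 <= 3)%N by rewrite /ncolors; case: ifP.
    rewrite -{1}(subnK c3) exprD -mulrA -exprMn.
    by apply: eqXM; rewrite ?eqXX // eqX_exp // part_series_eqX.
  apply: (eqX_trans (eqXM DE uG)).
  (* Euler's identity: the product of all 1 + X^m is inverse to that of 1 - X^m over odd m.
     Truncated, it is obtained here after multiplication by E. *)
  rewrite [X in eqX _ X _](_ : _ = E * (\prod_(i < M) (1 + 'X^(i.+1)) *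
      \prod_(i < M | odd i == false) (1 - 'X^(i.+1)))).
    apply: (eqX_trans (eqXM EE (eqXX _ _))).
    rewrite mulrCA EP mulrC [X in eqX _ (X * _) _](_ : _ = u) ?eqXX //.
    rewrite /u [RHS](bigID (fun i : 'I_M => odd i == true)) /=; congr (_ * _).
    by apply: eq_bigl => i; case: (odd i).
  rewrite EP /u -!big_split [\prod_(i < M | _) (1 + _)]big_mkcond.
  rewrite [\prod_(i < M | _) (1 - _)]big_mkcond -!big_split.
  apply: eq_bigr => i _ /=; rewrite /ncolors /=; case: (odd i) => /=; ring.
(* E is the term s = 0 of Shanks' sum, present because M > 0; the others are divisible by
   X^(2M+1). *)
rewrite /E; clear -M0; case: M M0 => // M _.
rewrite [\sum_(s < M.+1) _]big_ord_recl /= big_ord0 mul1r mul0n expr0 mulr1 big_mkord eqX_sym.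
rewrite /eqX addrAC subrr add0r.
elim/big_ind: _ => [|p q|s _]; [exact: dvdp0 | exact: dvdp_add |].
rewrite dvdp_mull // exprNn dvdp_mull // dvdp_exp2l // /bump /=; lia.
Qed.

End Truncation.

(** * Reduction modulo 3 and the three congruences *)

Lemma ncolors_affine (a b d e m : nat) :
  ncolors (3 * a + d) (3 * b + e) m = (3 * ncolors a b m + ncolors d e m)%N.
Proof. by rewrite /ncolors; case: odd. Qed.

(** The colour numbers 3a and 3b contribute a cube, which over F_3 does not mix residue classes of
    exponents. *)
Lemma abar_mod3 (a b d e M : nat) :
  (forall i, (i < M.+1)%N -> i = M %[mod 3] ->
     (\prod_(l < M) part_series 'F_3 M l.+1 ^+ ncolors d e l.+1)`_i = 0) ->
  (abar (3 * a + d) (3 * b + e) M = 0 %[mod 3])%N.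
Proof.
move=> h; apply/eqP; rewrite mod0n -/(3 %| _)%N (dvdn_pcharf (pchar_Fp (erefl : prime 3))).
rewrite abar_coef; apply/eqP.
under eq_bigr do rewrite ncolors_affine exprD mulnC exprM.
rewrite big_split prodrXl.
exact: (coef_mul_exp_pchar (pchar_Fp (erefl : prime 3)) _ h).
Qed.

(** 'C(t+4, 2) exceeds 'C(t+1, 2) by 3 (t+2), so the residue has period 3 in t. *)
Lemma triangular_mod3 (t : nat) : ('C(t.+1, 2) %% 3 != 2)%N.
Proof.
elim/ltn_ind: t => -[|[|[|t]]] // IH.
rewrite (_ : 'C(t.+4, 2) = t.+2 * 3 + 'C(t.+1, 2))%N ?modnMDl; last by rewrite !binS !bin0 !bin1; lia.
by apply: IH; lia.
Qed.

Local Close Scope ring_scope.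

Theorem theorem1p7 (n k j : nat) (hjk : j <= k) :
  [/\ abar (3 * (k - j) + 3) (3 * k + 6) (3 * n + 1) = 0 %[mod 3],
      abar (3 * (k - j) + 3) (3 * k + 6) (3 * n + 2) = 0 %[mod 3]
    & abar (3 * (k - j) + 5) (3 * k + 1) (3 * n + 2) = 0 %[mod 3]].
Proof.
(* With d = e = 0 the residual factor is 1, whose only nonzero coefficient has index 0. *)
have triv M : M %% 3 != 0 -> abar (3 * (k - j) + 3) (3 * k + 6) M = 0 %[mod 3].
  have := @abar_mod3 (k - j + 1) (k + 2) 0 0 M.
  rewrite !addn0 !mulnDr => h M3; apply: h => i _ iM; rewrite big1 => [|l _].
    by rewrite coef1; case: i iM => // /esym/eqP; rewrite mod0n (negPf M3).
  by rewrite /ncolors if_same expr0.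
split; try by apply: triv; rewrite mulnC modnMDl.
(* Here 3 (k - j) + 5 = 3 (k - j + 1) + 2, so the residual colour numbers are 2 and 1; the cube of
   the product of the 1 - X^m is then inserted. *)
have := @abar_mod3 (k - j + 1) k 2 1 (3 * n + 2).
rewrite mulnDr -addnA => h; apply: h.
apply: (@coef_cancel_exp_pchar _ _ (pchar_Fp (erefl : prime 3))
  (\prod_(i < 3 * n + 2) (1 - 'X^(i.+1))%R)).
  rewrite -horner_coef0 horner_prod big1 // => i _.
  by rewrite !hornerE expr0n subr0.
move=> i iN i2; rewrite (eqX_coef (overpartition21_eqX _ _) iN) ?addn2 //.
rewrite coef_sum big1 // => t _; rewrite exprNn -signr_odd.
rewrite mulr_sign -scaler_sign coefZ coefXn; case: eqP => [it|_]; last by rewrite mulr0.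
by have := triangular_mod3 t; rewrite -it i2 mulnC modnMDl.
Qed.
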